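(* Consider current status data: $\mathcal{Y}=[0,1]$, $\mathcal{Z}=[0,1]\times[0,1]$, $Z=(Y,C)$, $\pi(Y,C)=Y$, $\mathcal{X}=[0,1]\times\{0,1\}$, $X=\psi(Y,C)=(C,\mathbf{1}_{\{Y\le C\}})$, and $\mu_0(dy\,dc)=dy\,dc$ (Lebesgue measure on $[0,1]^2$). Let $\mathcal{P}_{\mathrm{CAR}}$ be the set of all distributions on $\mathcal{X}$ of the data $X$ when the distribution of $(Y,C)$ satisfies the CAR assumption relative to $\mu_0$, and let $\mathcal{P}$ be the set of all probability distributions on $\mathcal{X}$. Let $$A_1=\{(x,1):x\in[0,\tfrac12]\},\qquad A_2=\{(x,0):x\in[\tfrac12,1]\},$$ and $\Phi(P)=(P(A_1),P(A_2))$ for $P\in\mathcal{P}$. Then $$\Phi(\mathcal{P})=\{(a_1,a_2)\in[0,1]^2:\ a_1+a_2\le 1\},\qquad \Phi(\mathcal{P}_{\mathrm{CAR}})\subset\{(a_1,a_2)\in[0,1]^2:\ a_1+a_2\le 1,\ a_1a_2\le\tfrac1{16}\}.$$ Consequently $\Phi(\mathcal{P}_{\mathrm{CAR}})$ is a proper subset of $\Phi(\mathcal{P})$, so there is a distribution of the data that contradicts the CAR assumption.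
   Context: CAR assumption relative to $\mu_0$: a probability measure $\mu\ll\mu_0$ on $\mathcal{Z}$ satisfies CAR if and only if $\mu(dz)=g\circ\psi(z)\cdot h\circ\pi(z)\,\mu_0(dz)$, where $h$ is a probability density with respect to $Q_0=\pi(\mu_0)$ (here Lebesgue measure on $[0,1]$) and $g$ is a positive (i.e. $\ge 0$) measurable function on $\mathcal{X}$ with $E_{\mu_0}(g(X)|Y)=1$, i.e. here $\int_0^1 g(c,\mathbf{1}_{\{y\le c\}})\,dc=1$ for almost every $y\in[0,1]$. The distribution of the data under $\mu$ is the image measure $\psi(\mu)$ on $\mathcal{X}$. *)

(* Defs.v *)
From HB Require Import structures.
From mathcomp Require Import all_boot all_order all_algebra.
From mathcomp Require Import all_classical all_reals all_analysis.
From mathcomp Require Import measurable_realfun.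

Set Implicit Arguments.
Unset Strict Implicit.
Unset Printing Implicit Defensive.

Import Order.TTheory GRing.Theory Num.Theory.
Import numFieldNormedType.Exports.

Local Open Scope classical_set_scope.
Local Open Scope ring_scope.

(* [is_cond_exp mu0 pi f e] : e(Y), with Y = pi(Z), is a version of the
   conditional expectation E_mu0(f(Z) | Y).  Intended for nonnegative f and e,
   so that no integrability condition on f is needed. *)
Definition is_cond_exp (R : realType) (dZ dY : measure_display)
    (Z : measurableType dZ) (Y : measurableType dY)
    (mu0 : {measure set Z -> \bar R}) (pi : {mfun Z >-> Y})
    (f : Z -> R) (e : Y -> R) : Prop :=
  measurable_fun setT e /\
  forall B : set Y, measurable B ->
    (\int[mu0]_(z in pi @^-1` B) (f z)%:E =
     \int[mu0]_(z in pi @^-1` B) (e (pi z))%:E)%E.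

(* Coarsening at random for the data X = psi(Z) on Y = pi(Z), relative to mu0:
   mu(dz) = g(psi(z)) h(pi(z)) mu0(dz), where h is a probability density with
   respect to the image pi(mu0) and E_mu0(g(X) | Y) = 1. *)
Definition CAR (R : realType) (dZ dY dX : measure_display)
    (Z : measurableType dZ) (Y : measurableType dY) (X : measurableType dX)
    (mu0 : {measure set Z -> \bar R}) (pi : {mfun Z >-> Y})
    (psi : {mfun Z >-> X}) (mu : probability Z R) : Prop :=
  mu `<< mu0 /\
  exists (g : {mfun X >-> R}) (h : {mfun Y >-> R}),
  [/\ (forall x, 0 <= g x) /\ is_cond_exp mu0 pi (g \o psi) (cst 1),
      (forall y, 0 <= h y) /\ (\int[pushforward mu0 pi]_y (h y)%:E = 1)%E &
      forall A : set Z, measurable A ->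
        (mu A = \int[mu0]_(z in A) (g (psi z) * h (pi z))%:E)%E].

(* Current status data.  The spaces [0,1], [0,1]^2 and [0,1] x {0,1} are
   represented as measurable subsets of R, R * R and R * bool; measures on them
   are measures on the ambient type that do not charge the complement, and
   functions on them are extended to the ambient type (e.g. by zero).
   [measurableTypeR R] is R with its Borel sigma-algebra, the carrier of
   [lebesgue_measure]. *)

Notation csY R := (measurableTypeR R).
Notation csZ R := (measurableTypeR R * measurableTypeR R)%type.
Notation csX R := (measurableTypeR R * bool)%type.

Definition cs_square (R : realType) : set (csZ R) := `[0, 1] `*` `[0, 1].

Lemma measurable_cs_square (R : realType) : measurable (@cs_square R).
Proof. by apply: measurableX; exact: measurable_itv. Qed.

Definition cs_mu0 (R : realType) : {measure set (csZ R) -> \bar R} :=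
  mrestr (@lebesgue_measure R \x @lebesgue_measure R)%E
    (@measurable_cs_square R).

Definition cs_pi (R : realType) : csZ R -> csY R := fst.

Lemma measurable_cs_pi (R : realType) : measurable_fun setT (@cs_pi R).
Proof. exact: measurable_fst. Qed.

HB.instance Definition _ (R : realType) :=
  isMeasurableFun.Build _ _ _ _ (@cs_pi R) (@measurable_cs_pi R).

(* z = (y, c) is mapped to (c, 1_{y <= c}). *)
Definition cs_psi (R : realType) (z : csZ R) : csX R :=
  (z.2, (z.1 : R) <= z.2).

Lemma measurable_cs_psi (R : realType) : measurable_fun setT (@cs_psi R).
Proof.
apply: measurable_fun_pair; first exact: measurable_snd.
apply: measurable_fun_ler; [exact: measurable_fst|exact: measurable_snd].
Qed.

HB.instance Definition _ (R : realType) :=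
  isMeasurableFun.Build _ _ _ _ (@cs_psi R) (@measurable_cs_psi R).

Definition cs_data (R : realType) : set (csX R) := `[0, 1] `*` setT.

Definition cs_laws (R : realType) : set (probability (csX R) R) :=
  [set P | P (@cs_data R) = 1%E].

(* The law of the data under mu is compared with P on measurable sets only:
   the values of a library measure outside the sigma-algebra are junk.
   Absolute continuity of mu forces mu to be carried by the unit square. *)
Definition cs_CAR_laws (R : realType) : set (probability (csX R) R) :=
  [set P | exists mu : probability (csZ R) R,
     CAR (@cs_mu0 R) (@cs_pi R) (@cs_psi R) mu /\
     forall A : set (csX R), measurable A ->
       P A = pushforward mu (@cs_psi R) A].

Definition cs_A1 (R : realType) : set (csX R) :=
  `[0, 2^-1] `*` [set true].

Definition cs_A2 (R : realType) : set (csX R) :=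
  `[2^-1, 1] `*` [set false].

Definition cs_Phi (R : realType) (P : probability (csX R) R) : R * R :=
  (fine (P (@cs_A1 R)), fine (P (@cs_A2 R))).

(* Main.v *)
Require Import Defs.
From HB Require Import structures.
From mathcomp Require Import all_boot all_order all_algebra.
From mathcomp Require Import all_classical all_reals all_analysis.
From mathcomp Require Import measurable_realfun lra.

Set Implicit Arguments.
Unset Strict Implicit.
Unset Printing Implicit Defensive.

Import Order.TTheory GRing.Theory Num.Theory.
Import numFieldNormedType.Exports.

Local Open Scope classical_set_scope.
Local Open Scope ring_scope.

(** Write u(c) = g(c,1) and v(c) = g(c,0) for the two branches of the CAR
factor g, and H for the distribution function of the density h.  Under CAR the
law of the data gives A1 the mass of u(c) H(c) over [0,1/2], and A2 the mass of
v(c) (1 - H(c)) over [1/2,1].  By monotonicity of H these are at most H(1/2) p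
and (1 - H(1/2)) q, where p and q are the integrals of u over [0,1/2] and of v
over [1/2,1].

The CAR identity says that the integral of u over [y,1] plus that of v over
[0,y] is 1 for almost every y.  Taking y near 0, near 1 and near 1/2 gives
[int_0^1 u <= 1], [int_0^1 v <= 1] and [1 <= int_(1/2)^1 u + int_0^(1/2) v];
subtracting the third relation from the sum of the first two leaves p + q <= 1
([car_halves_le1]).  Hence the product of the two masses is at most
H(1/2) (1 - H(1/2)) p q <= 1/4 * 1/4 ([cs_CAR_law_bound]).

No exceptional null set of y is ever handled: integrating the CAR identity over
a strip a < y < b, on which the integrand is squeezed between two functions of
c alone, yields inequalities valid for all 0 <= a < b <= 1 ([car_strip_le1],
[car_strip_ge1]).

Without CAR, three point masses realize every point of the simplex
([exists_cs_law]).  The point (1/2, 1/2) has product 1/4 > 1/16, so its law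
contradicts CAR. *)

(** * Integrals over restrictions and rectangles *)

(** The complement of [D] is negligible for the restriction of [mu] to [D],
and on the subsets of [D] the two measures agree. *)
Lemma ge0_integral_mrestr d (T : measurableType d) (R : realType)
    (mu : {measure set T -> \bar R}) (D : set T) (mD : measurable D)
    (A : set T) (f : T -> \bar R) :
  measurable A -> measurable_fun A f -> (forall x, A x -> (0 <= f x)%E) ->
  (\int[mrestr mu mD]_(x in A) f x = \int[mu]_(x in A `&` D) f x)%E.
Proof.
move=> mA mf f0.
rewrite (@ge0_negligible_integral _ _ _ _ A (~` D))//; last 2 first.
- exact: measurableC.
- by rewrite /= /mrestr setICl measure0.
rewrite setDE setCK; apply: eq_measure_integral => B mB BAD.
by rewrite /= /mrestr setIidl// => x /BAD[].
Qed.

Lemma ge0_integral_rectangle d1 d2 (T1 : measurableType d1)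
    (T2 : measurableType d2) (R : realType)
    (m1 : {sigma_finite_measure set T1 -> \bar R})
    (m2 : {sigma_finite_measure set T2 -> \bar R})
    (A : set T1) (B : set T2) (f : T1 -> \bar R) (k : T2 -> \bar R) :
  measurable A -> measurable B ->
  measurable_fun setT f -> measurable_fun setT k ->
  (forall x, (0 <= f x)%E) -> (forall y, (0 <= k y)%E) ->
  (\int[m1 \x m2]_(z in A `*` B) (f z.1 * k z.2) =
   \int[m1]_(x in A) f x * \int[m2]_(y in B) k y)%E.
Proof.
move=> mA mB mf mk f0 k0.
rewrite integral_mkcond.
have -> : ((fun z => f z.1 * k z.2) \_ (A `*` B) =
           fun z => (f \_ A) z.1 * (k \_ B) z.2)%E.
  apply/funext => -[x y]; rewrite !patchE in_setX/=.
  by case: (x \in A); case: (y \in B); rewrite /= ?mul0e ?mule0.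
have mfA : measurable_fun setT (f \_ A).
  by apply/(measurable_restrictT _ _).1 => //; exact: measurable_funTS.
have mkB : measurable_fun setT (k \_ B).
  by apply/(measurable_restrictT _ _).1 => //; exact: measurable_funTS.
have fA0 x : (0 <= (f \_ A) x)%E by exact: erestrict_ge0.
have kB0 x : (0 <= (k \_ B) x)%E by exact: erestrict_ge0.
rewrite fubini_tonelli1//=; last 2 first.
- by apply: emeasurable_funM; exact: measurableT_comp.
- by move=> z; exact: mule_ge0.
rewrite /fubini_F/=.
under eq_integral do rewrite ge0_integralZl//.
by rewrite ge0_integralZr ?integral_ge0// -!integral_mkcond.
Qed.

Lemma cvg_integral_itvoo (R : realType) (f : R -> \bar R) (a b : R)
    (F : (set (measurableTypeR R))^nat) :
  measurable_fun setT f -> (forall x, (0 <= f x)%E) ->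
  nondecreasing_seq F -> (forall n, measurable (F n)) ->
  \bigcup_n F n = `]a, b[%classic ->
  (\int[lebesgue_measure]_(x in F n) f x @[n --> \oo] -->
   \int[lebesgue_measure]_(x in `]a, b[) f x)%E.
Proof.
move=> mf f0 ndF mF <-; apply: ge0_nondecreasing_set_cvg_integral => //.
by move=> n; exact: measurable_funTS.
Qed.

(** * Two inequalities between extended reals *)

(** All the terms are finite because the sums on the left are at most 1, so
[b + c] can be subtracted from the sum of the first two inequalities. *)
Lemma lee_exchange (R : realType) (a b c d : \bar R) :
  (0 <= a)%E -> (0 <= b)%E -> (0 <= c)%E -> (0 <= d)%E ->
  (a + b <= 1)%E -> (c + d <= 1)%E -> (1 <= b + c)%E -> (a + d <= 1)%E.
Proof.
move: a b c d => [a||] [b||] [c||] [d||]//.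
by rewrite -!EFinD !lee_fin; lra.
Qed.

(** Two nonnegative numbers with sum at most 1 have product at most 1/4; this
is applied to the pair [h, k] and to the pair [a, b]. *)
Lemma fineM_le_16th (R : realType) (p q h k a b : \bar R) :
  (0 <= p)%E -> (0 <= q)%E -> (0 <= h)%E -> (0 <= k)%E -> (0 <= a)%E ->
  (0 <= b)%E -> (h + k = 1)%E -> (a + b <= 1)%E -> (p <= h * a)%E ->
  (q <= k * b)%E -> fine p * fine q <= 1 / 16.
Proof.
move: h k a b => [h||] [k||]// [a||] [b||]//.
move: p q => [p||] [q||]//; rewrite -?EFinM -?EFinD !lee_fin/=.
move=> p0 q0 h0 k0 a0 b0 [hk] ab ph qk.
have quarter (x y : R) : 0 <= x -> 0 <= y -> x + y <= 1 -> x * y <= 1 / 4.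
  move=> x0 y0 xy; have := sqr_ge0 (x - y).
  have : (x + y) ^+ 2 <= 1 by rewrite expr_le1// addr_ge0.
  by rewrite !expr2; lra.
have hk4 : h * k <= 1 / 4 by apply: quarter => //; rewrite hk.
have ab4 : a * b <= 1 / 4 by exact: quarter.
have -> : (1 / 16 : R) = (1 / 4) * (1 / 4) by lra.
apply: (le_trans (ler_pM p0 q0 ph qk)).
by rewrite mulrACA ler_pM// mulr_ge0.
Qed.

(** * Integration over the unit square *)

Section current_status.
Variable R : realType.
Local Notation leb := (@lebesgue_measure R).

(** Specializing [ge0_integral_mrestr] keeps the reference measure folded:
unification against the general form unfolds it down to the construction of the
Lebesgue measure. *)
Lemma ge0_integral_cs_square (A : set (csZ R)) (f : csZ R -> \bar R) :
  measurable A -> measurable_fun A f -> (forall x, A x -> (0 <= f x)%E) ->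
  (\int[@cs_mu0 R]_(z in A) f z =
   \int[(leb \x leb)%E]_(z in A `&` @cs_square R) f z)%E.
Proof. exact: ge0_integral_mrestr. Qed.

Lemma ge0_integral_cs_mu0 (A B : set (csY R)) (f k : csY R -> \bar R) :
  measurable A -> measurable B ->
  measurable_fun setT f -> measurable_fun setT k ->
  (forall x, (0 <= f x)%E) -> (forall y, (0 <= k y)%E) ->
  (\int[@cs_mu0 R]_(z in A `*` B) (f z.1 * k z.2) =
   \int[leb]_(x in A `&` `[0%R, 1%R]) f x *
   \int[leb]_(y in B `&` `[0%R, 1%R]) k y)%E.
Proof.
move=> mA mB mf mk f0 k0.
rewrite ge0_integral_cs_square//=; last 3 first.
- exact: measurableX.
- apply: emeasurable_funM; apply: measurable_funTS; exact: measurableT_comp.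
- by move=> z _; exact: mule_ge0.
by rewrite /cs_square -setXI ge0_integral_rectangle//; exact: measurableI.
Qed.

(** * The CAR identity averaged over strips *)

Section coarsening.
Variable g : {mfun csX R >-> R}.
Hypothesis g0 : forall x, 0 <= g x.
Hypothesis gCAR : is_cond_exp (@cs_mu0 R) (@cs_pi R) (g \o @cs_psi R) (cst 1).

Let u (c : csY R) : \bar R := (g (c, true))%:E.
Let v (c : csY R) : \bar R := (g (c, false))%:E.

Let meas_u : measurable_fun setT u.
Proof.
by apply/measurable_EFinP; apply: (measurableT_comp (f := g)).
Qed.

Let meas_v : measurable_fun setT v.
Proof.
by apply/measurable_EFinP; apply: (measurableT_comp (f := g)).
Qed.

Let u0 c : (0 <= u c)%E. Proof. by rewrite lee_fin. Qed.
Let v0 c : (0 <= v c)%E. Proof. by rewrite lee_fin. Qed.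

Let integral_strip_g (a b : R) : 0 <= a -> a < b -> b <= 1 ->
  (\int[@cs_mu0 R]_(z in `]a, b[ `*` setT) (g (cs_psi z))%:E = (b - a)%:E)%E.
Proof.
move=> a0 ab b1.
have -> : `]a, b[ `*` setT = @cs_pi R @^-1` `]a, b[.
  by apply/seteqP; split => z; [case|split].
have mab : measurable (`]a, b[ : set (csY R)) by exact: measurable_itv.
rewrite (gCAR.2 _ mab).
have -> : @cs_pi R @^-1` `]a, b[ = `]a, b[ `*` setT.
  by apply/seteqP; split => z; [split|case].
transitivity (\int[@cs_mu0 R]_(z in `]a, b[ `*` setT)
  (cst 1%E z.1 * cst 1%E z.2))%E.
  by apply: eq_integral => z _; rewrite /= mule1.
rewrite ge0_integral_cs_mu0// !integral_cst; [|exact: measurableI..].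
rewrite setTI (@setIidl _ `]a, b[); last first.
  move=> x /=; rewrite !in_itv/= => /andP[ax xb].
  by rewrite (le_trans a0 (ltW ax)) (le_trans (ltW xb)).
rewrite !mul1e/= !lebesgue_measure_itv/= !lte_fin ab ltr01.
by rewrite -!EFinB subr0 mule1.
Qed.

Let meas_w (A B : set (csY R)) : measurable A -> measurable B ->
  measurable_fun setT ((u \_ A) \+ (v \_ B))%E.
Proof.
move=> mA mB; apply: emeasurable_funD.
  by apply/(measurable_restrictT _ _).1 => //; exact: measurable_funTS.
by apply/(measurable_restrictT _ _).1 => //; exact: measurable_funTS.
Qed.

Let w0 (A B : set (csY R)) c : (0 <= ((u \_ A) \+ (v \_ B)) c)%E.
Proof. by apply: adde_ge0; apply: erestrict_ge0. Qed.

(** A function of [c] alone, equal to [u] on [A] plus [v] on [B], integrates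
over the strip as a product; the two bounds on the CAR factor below have this form. *)
Let integral_strip_w (a b : R) (A B : set (csY R)) :
  0 <= a -> a < b -> b <= 1 ->
  measurable A -> measurable B -> A `<=` `[0, 1] -> B `<=` `[0, 1] ->
  (\int[@cs_mu0 R]_(z in `]a, b[ `*` setT) ((u \_ A) \+ (v \_ B)) z.2 =
   (b - a)%:E * (\int[leb]_(c in A) u c + \int[leb]_(c in B) v c))%E.
Proof.
move=> a0 ab b1 mA mB A01 B01.
transitivity (\int[@cs_mu0 R]_(z in `]a, b[ `*` setT)
  (cst 1%E z.1 * ((u \_ A) \+ (v \_ B)) z.2))%E.
  by apply: eq_integral => z _; rewrite /= mul1e.
rewrite (ge0_integral_cs_mu0 (f := cst 1%E) (k := ((u \_ A) \+ (v \_ B))%E))//;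
  last exact: meas_w.
congr (_ * _)%E.
  rewrite integral_cst ?mul1e; [|exact: measurableI].
  rewrite (@setIidl _ `]a, b[); last first.
    move=> x /=; rewrite !in_itv/= => /andP[ax xb].
    by rewrite (le_trans a0 (ltW ax)) (le_trans (ltW xb)).
  by rewrite /= lebesgue_measure_itv/= lte_fin ab -EFinB.
rewrite setTI ge0_integralD//=.
- by rewrite -!integral_mkcondr !setIidr.
- by move=> x _; exact: erestrict_ge0.
- apply: measurable_funTS; apply/(measurable_restrictT _ _).1 => //.
  exact: measurable_funTS.
- by move=> x _; exact: erestrict_ge0.
- apply: measurable_funTS; apply/(measurable_restrictT _ _).1 => //.
  exact: measurable_funTS.
Qed.

Let meas_g_psi (D : set (csZ R)) :
  measurable_fun D (fun z => (g (cs_psi z))%:E).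
Proof.
apply: measurable_funTS; apply/measurable_EFinP.
exact: (measurableT_comp (f := g)).
Qed.

Let meas_w_snd (D : set (csZ R)) (A B : set (csY R)) :
  measurable A -> measurable B ->
  measurable_fun D (fun z => ((u \_ A) \+ (v \_ B)) z.2)%E.
Proof.
move=> mA mB; apply: measurable_funTS.
by apply: (@measurableT_comp _ _ _ _ _ _ ((u \_ A) \+ (v \_ B))%E);
  [exact: meas_w|exact: measurable_snd].
Qed.

(** For y in ]a, b[, a point c >= b satisfies y <= c and sees [u], while a
point c <= a satisfies c < y and sees [v].  So [u] on [[b, 1]] plus [v] on
[[0, a]] is below the CAR factor on the whole strip, whose total is b - a. *)
Lemma car_strip_le1 (a b : R) : 0 <= a -> a < b -> b <= 1 ->
  (\int[leb]_(c in `[b, 1%R]) u c + \int[leb]_(c in `[0%R, a]) v c <= 1)%E.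
Proof.
move=> a0 ab b1; have ba0 : 0 < b - a by rewrite subr_gt0.
rewrite -(@lee_pmul2l _ (b - a)%:E)// mule1.
rewrite -integral_strip_w//; last 2 first.
- move=> x/=; rewrite !in_itv/= => /andP[bx ->]; rewrite andbT.
  by rewrite (le_trans _ bx)// (le_trans a0)// ltW.
- move=> x/=; rewrite !in_itv/= => /andP[-> xa]/=.
  by rewrite (le_trans xa)// (le_trans (ltW ab)).
rewrite -integral_strip_g//; apply: ge0_le_integral => //.
- exact: measurableX.
- exact: meas_w_snd.
move=> [y c] [/=]; rewrite in_itv/= => /andP[ay yb] _.
rewrite !patchE !mem_setE/= !in_itv/= /cs_psi/=.
case: (leP y c) => [yc|cy].
  rewrite [X in (_ + X)%E](_ : _ = 0%E) ?adde0.
    by case: ifP => // _; exact: u0.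
  by rewrite (lt_geF (lt_le_trans ay yc)) andbF.
rewrite [X in (X + _)%E](_ : _ = 0%E) ?add0e.
  by case: ifP => // _; exact: v0.
by rewrite (lt_geF (lt_trans cy yb)).
Qed.

(** The converse bound: for y in ]a, b[, the factor is [u c] only if c > a and
[v c] only if c < b. *)
Lemma car_strip_ge1 (a b : R) : 0 <= a -> a < b -> b <= 1 ->
  (1 <= \int[leb]_(c in `[a, 1%R]) u c + \int[leb]_(c in `[0%R, b]) v c)%E.
Proof.
move=> a0 ab b1; have ba0 : 0 < b - a by rewrite subr_gt0.
rewrite -(@lee_pmul2l _ (b - a)%:E)// mule1.
rewrite -integral_strip_w//; last 2 first.
- move=> x/=; rewrite !in_itv/= => /andP[bx ->]; rewrite andbT.
  by rewrite (le_trans _ bx).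
- move=> x/=; rewrite !in_itv/= => /andP[-> xa]/=.
  by rewrite (le_trans xa).
have mD : measurable (`]a, b[ `*` setT : set (csZ R)) by exact: measurableX.
have gpsi0 z : (0 <= (g (cs_psi z))%:E)%E by rewrite lee_fin.
rewrite -integral_strip_g//.
(* The pointwise bound needs 0 <= c <= 1, hence the return to the square. *)
rewrite (ge0_integral_cs_square mD (@meas_g_psi _) (fun z _ => gpsi0 z)).
have mA : measurable (`[a, 1] : set (csY R)) by exact: measurable_itv.
have mB : measurable (`[0, b] : set (csY R)) by exact: measurable_itv.
rewrite (ge0_integral_cs_square mD (@meas_w_snd _ _ _ mA mB))//.
apply: ge0_le_integral => //.
- apply: measurableI; [exact: measurableX|exact: measurable_cs_square].
- exact: meas_w_snd.
move=> [y c] [[/=]]; rewrite in_itv/= => /andP[ay yb] _.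
rewrite /cs_square/= !in_itv/= => -[_ /andP[c0 c1]].
rewrite !patchE !mem_setE/= !in_itv/= /cs_psi/= c0 c1 andbT/=.
case: (leP y c) => [yc|cy].
  rewrite (le_trans (ltW ay) yc) -[leLHS]adde0; apply: leeD => //.
  by case: ifP => // _; exact: v0.
rewrite (le_trans (ltW cy) (ltW yb)) -[leLHS]add0e; apply: leeD => //.
by case: ifP => // _; exact: u0.
Qed.

(** * The total weight of the two halves *)

Let integral_split (f : csY R -> \bar R) (A B C : set (csY R)) :
  measurable A -> measurable B -> measurable_fun setT f ->
  (forall x, 0 <= f x)%E -> A `|` B = C -> A `&` B = set0 ->
  (\int[leb]_(x in C) f x = \int[leb]_(x in A) f x + \int[leb]_(x in B) f x)%E.
Proof.
move=> mA mB mf f0 <- AB; apply: ge0_integral_setU => //.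
- exact: measurable_funTS.
- by rewrite disj_set2E AB.
Qed.

(** The strips ]0, e[, ]1 - e, 1[ and ]1/2, 1/2 + e[ provide the three
relations combined by [lee_exchange].  The trimming by [e] is the price of
averaging; [e <= 1/4] keeps 1/2 + e below 1 - e. *)
Lemma car_trimmed_halves_le1 (e : R) : 0 < e -> e <= 4^-1 ->
  (\int[leb]_(c in `[e, 2^-1%R[) u c +
   \int[leb]_(c in `](2^-1 + e)%R, (1 - e)%R]) v c <= 1)%E.
Proof.
move=> e0 e4.
have e1 : e <= 1 by lra.
have u1 : (\int[leb]_(c in `[e, 1%R]) u c <= 1)%E.
  apply: le_trans (car_strip_le1 (lexx 0) e0 e1).
  by rewrite leeDl// integral_ge0// => x _; exact: v0.
have ee1 : 1 - e < 1 by lra.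
have ee0 : 0 <= 1 - e by lra.
have v1 : (\int[leb]_(c in `[0%R, (1 - e)%R]) v c <= 1)%E.
  apply: le_trans (car_strip_le1 ee0 ee1 (lexx 1)).
  by rewrite leeDr// integral_ge0// => x _; exact: u0.
have h0 : (0 : R) <= 2^-1 by lra.
have h1 : (2^-1 : R) < 2^-1 + e by lra.
have h2 : 2^-1 + e <= 1 by lra.
apply: (lee_exchange _ _ _ _ _ _ (car_strip_ge1 h0 h1 h2)) => //;
  [by apply: integral_ge0 => x _; rewrite lee_fin .. | |].
- rewrite -(@integral_split u `[e, 2^-1[ `[2^-1, 1] `[e, 1])//.
  + apply/seteqP; split => [x [|]|x] /=; rewrite !in_itv/=; [lra|lra|].
    by case: (ltP x 2^-1) => xh; [left|right]; lra.
  + by apply/seteqP; split => // x [/=]; rewrite !in_itv/=; lra.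
- rewrite -(@integral_split v `[0, 2^-1 + e] `]2^-1 + e, 1 - e] `[0, 1 - e])//.
  + apply/seteqP; split => [x [|]|x] /=; rewrite !in_itv/=; [lra|lra|].
    by case: (leP x (2^-1 + e)) => xh; [left|right]; lra.
  + by apply/seteqP; split => // x [/=]; rewrite !in_itv/=; lra.
Qed.

(** Monotone convergence along [e n = 1 / (n + 4)], whose first value is the
largest one allowed by [car_trimmed_halves_le1]. *)
Lemma car_halves_le1 :
  (\int[leb]_(c in `]0%R, 2^-1%R[) u c + \int[leb]_(c in `]2^-1%R, 1%R[) v c
   <= 1)%E.
Proof.
pose e n : R := n.+4%:R^-1.
have e0 n : 0 < e n by rewrite invr_gt0.
have e4 n : e n <= 4^-1 by rewrite lef_pV2 ?posrE// ler_nat.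
have ed n m : (n <= m)%N -> e m <= e n.
  by move=> nm; rewrite lef_pV2 ?posrE// ler_nat !ltnS.
have esmall x : 0 < x -> exists n, e n < x.
  move=> /ltr_add_invr[n]; rewrite add0r => nx; exists n.
  by apply: le_lt_trans nx; rewrite lef_pV2 ?posrE// ler_nat -addn3 leq_addr.
have cu := @cvg_integral_itvoo R u 0 2^-1
  (fun n => `[e n, 2^-1[%classic) meas_u u0.
have cv := @cvg_integral_itvoo R v 2^-1 1
  (fun n => `]2^-1 + e n, 1 - e n]%classic) meas_v v0.
have {}cu : (\int[leb]_(x in `[e n, 2^-1%R[) u x @[n --> \oo] -->
  \int[leb]_(c in `]0%R, 2^-1%R[) u c)%E.
  apply: cu => //.
  - move=> n m nm; apply/subsetPset => x /=; rewrite !in_itv/= => /andP[ex ->].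
    by rewrite (le_trans (ed _ _ nm)).
  - apply/seteqP; split => [x [n _]|x]/=; rewrite !in_itv/= => /andP[].
      by move=> /(lt_le_trans (e0 n)) -> ->.
    move=> /esmall[n xn] x2; exists n => //=.
    by rewrite in_itv/= x2 ltW.
have {}cv : (\int[leb]_(x in `](2^-1 + e n)%R, (1 - e n)%R]) v x
  @[n --> \oo] -->
  \int[leb]_(c in `]2^-1%R, 1%R[) v c)%E.
  apply: cv => //.
  - move=> n m nm; apply/subsetPset => x /=; rewrite !in_itv/=.
    have := ed _ _ nm; lra.
  - apply/seteqP; split => [x [n _]|x]/=; rewrite !in_itv/=.
      have := e0 n; lra.
    move=> /andP[x2 x1].
    have /esmall[n] : 0 < Num.min (x - 2^-1) (1 - x).
      by rewrite lt_min !subr_gt0 x2 x1.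
    rewrite lt_min => /andP[n1 n2]; exists n => //=.
    rewrite in_itv/=; lra.
have Iu : (0 <= \int[leb]_(c in `]0%R, 2^-1%R[) u c)%E by exact: integral_ge0.
have Iv : (0 <= \int[leb]_(c in `]2^-1%R, 1%R[) v c)%E by exact: integral_ge0.
have cuv := cvgeD (FF := eventually_filter) (ge0_adde_def Iu Iv) cu cv.
rewrite -(cvg_lim _ cuv)//; apply: lime_le.
  by apply/cvg_ex; eexists; exact: cuv.
by near=> n; exact: car_trimmed_halves_le1.
Unshelve. all: by end_near. Qed.

End coarsening.

(** * Laws of the data *)

Lemma measurable_cs_A1 : measurable (@cs_A1 R).
Proof. exact: measurableX. Qed.

Lemma measurable_cs_A2 : measurable (@cs_A2 R).
Proof. exact: measurableX. Qed.

Lemma measurable_cs_data : measurable (@cs_data R).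
Proof. exact: measurableX. Qed.

Lemma cs_Phi_simplex (P : probability (csX R) R) :
  [/\ 0 <= (cs_Phi P).1 <= 1, 0 <= (cs_Phi P).2 <= 1 &
      (cs_Phi P).1 + (cs_Phi P).2 <= 1].
Proof.
have mA1 := measurable_cs_A1; have mA2 := measurable_cs_A2.
have le1 A : measurable A -> 0 <= fine (P A) <= 1.
  move=> mA; rewrite fine_ge0//= -lee_fin fineK ?probability_le1//.
  exact: fin_num_measure.
split; [exact: le1..|].
rewrite /cs_Phi/= -lee_fin EFinD !fineK; [|exact: fin_num_measure..].
rewrite -measureU//; first by apply: probability_le1; exact: measurableU.
by apply/seteqP; split => // -[c b] [[/= _ ->] [/= _]].
Qed.

(** Masses [a] at (0,1) in A1, [b] at (1,0) in A2, and the remainder at (1,1),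
which lies in neither set. *)
Lemma exists_cs_law (a b : R) : 0 <= a -> 0 <= b -> a + b <= 1 ->
  exists P : probability (csX R) R, @cs_laws R P /\ cs_Phi P = (a, b).
Proof.
move=> a0 b0 ab1.
have half0 : (0 : R) <= 2^-1 by lra.
have half1 : (2^-1 : R) <= 1 by lra.
have half2 : (1 <= (2^-1 : R)) = false by apply/negbTE; lra.
have c0 : 0 <= 1 - (a + b) by lra.
pose x1 : csX R := (0 : R, true); pose x2 : csX R := (1 : R, false).
pose x3 : csX R := (1 : R, true).
pose m : {measure set (csX R) -> \bar R} := measure_add
  (mscale (NngNum a0) (\d_x1))
  (measure_add (mscale (NngNum b0) \d_x2) (mscale (NngNum c0) \d_x3)).
have mE A : m A = (a * (x1 \in A)%:R +
    (b * (x2 \in A)%:R + (1 - (a + b)) * (x3 \in A)%:R))%:E.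
  apply: (etrans (measure_addE _ _ _)).
  by rewrite [X in (_ + X)%E](measure_addE _ _ A).
have mT : m setT = 1%E by rewrite mE !in_setT/=; congr EFin; lra.
(* [m] has total mass 1, so normalizing only packages it as a probability; the
   Dirac mass is the fallback value for degenerate measures. *)
pose P : probability (csX R) R := mnormalize m \d_x1.
have PE A : P A = m A.
  rewrite /P /= /mnormalize mT eqe oner_eq0/=.
  by rewrite invr1 mule1.
exists P; split.
  rewrite /cs_laws/= PE mE /cs_data !in_setX !in_setT !mem_setE/= !in_itv/=.
  by rewrite !lexx ler01/=; congr EFin; lra.
rewrite /cs_Phi !PE !mE /cs_A1 /cs_A2 !in_setX/= !mem_setE/= !in_itv/=.
have bE (b1 b2 : bool) : (b1 \in [set b2]%classic) = (b1 == b2).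
  by apply/idP/eqP; rewrite inE.
rewrite !lexx half0 half1 half2 ler01 !bE/=.
by rewrite andbF; congr pair; rewrite /=; lra.
Qed.

(** * Data laws under CAR *)

Section density.
Variables (g : {mfun csX R >-> R}) (h : {mfun csY R >-> R}).
Hypotheses (g0 : forall x, 0 <= g x) (h0 : forall y, 0 <= h y).

(** On the preimage of [A] the density is [h y] times the branch [b] of [g], a
product in separated variables; enlarging the domain to the rectangle
[I `*` J] can only increase the integral of this product. *)
Lemma cs_density_le (A : set (csX R)) (I J : set (csY R)) (b : bool) :
  measurable A -> measurable I -> measurable J ->
  I `<=` `[0, 1] -> J `<=` `[0, 1] ->
  (forall z, @cs_square R z -> A (cs_psi z) ->
     [/\ I z.1, J z.2 & (cs_psi z).2 = b]) ->
  (\int[@cs_mu0 R]_(z in @cs_psi R @^-1` A) (g (cs_psi z) * h (cs_pi z))%:E <=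
   \int[leb]_(y in I) (h y)%:E * \int[leb]_(c in J) (g (c, b))%:E)%E.
Proof.
move=> mA mI mJ I01 J01 AIJ.
have mpA : measurable (@cs_psi R @^-1` A).
  by rewrite -[X in measurable X]setTI; exact: measurable_cs_psi.
have mgb : measurable_fun setT (fun c : csY R => (g (c, b))%:E).
  by apply/measurable_EFinP; apply: (measurableT_comp (f := g)).
have mh : measurable_fun setT (fun y => (h y)%:E) by apply/measurable_EFinP.
have E := @ge0_integral_cs_mu0 I J (fun y => (h y)%:E)
  (fun c => (g (c, b))%:E) mI mJ mh mgb.
rewrite !setIidl// in E; rewrite -E; last 2 first.
- by move=> y; rewrite lee_fin.
- by move=> c; rewrite lee_fin.
have mIJ : measurable (I `*` J) by exact: measurableX.
have mgh : measurable_fun (@cs_psi R @^-1` A)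
    (fun z => (g (cs_psi z) * h (cs_pi z))%:E).
  apply: measurable_funTS; apply/measurable_EFinP; apply: measurable_funM.
    exact: (measurableT_comp (f := g)).
  exact: (measurableT_comp (f := h)).
have mhg D : measurable_fun D (fun z : csZ R => (h z.1)%:E * (g (z.2, b))%:E)%E.
  apply: measurable_funTS; apply: emeasurable_funM.
    exact: (measurableT_comp mh).
  exact: (measurableT_comp mgb).
have gh0 z : (0 <= (g (cs_psi z) * h (cs_pi z))%:E)%E.
  by rewrite lee_fin mulr_ge0.
have hg0 z : (0 <= (h z.1)%:E * (g (z.2, b))%:E)%E.
  by rewrite mule_ge0// lee_fin.
rewrite (ge0_integral_cs_square mpA mgh (fun z _ => gh0 z)).
rewrite (ge0_integral_cs_square mIJ (@mhg _) (fun z _ => hg0 z)).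
rewrite (@eq_integral _ _ _ _ _ (fun z => (h z.1)%:E * (g (z.2, b))%:E)%E).
  apply: ge0_subset_integral => //.
  - by apply: measurableI => //; exact: measurable_cs_square.
  - by apply: measurableI => //; exact: measurable_cs_square.
  - by move=> z [Az sz]; have [Iz Jz _] := AIJ _ sz Az.
move=> z; rewrite inE => -[Az sz]; have [_ _ zb] := AIJ _ sz Az.
by rewrite EFinM muleC -zb.
Qed.

Hypothesis h1 : (\int[pushforward (@cs_mu0 R) (@cs_pi R)]_y (h y)%:E = 1)%E.

Lemma cs_marginal_density : (\int[leb]_(y in `[0%R, 1%R]) (h y)%:E = 1)%E.
Proof.
have mh : measurable_fun setT (fun y => (h y)%:E) by apply/measurable_EFinP.
rewrite -h1 ge0_integral_pushforward//; last by move=> y _; rewrite lee_fin.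
rewrite preimage_setT -setXTT.
have E := @ge0_integral_cs_mu0 setT setT (fun y => (h y)%:E) (cst 1%E)
  measurableT measurableT mh (measurable_cst _).
transitivity
  (\int[@cs_mu0 R]_(z in setT `*` setT) ((h z.1)%:E * cst 1%E z.2))%E;
  last by apply: eq_integral => z _; rewrite /= mule1.
rewrite E; [|by move=> y; rewrite lee_fin|by []].
rewrite !setTI integral_cst// mul1e/=.
by rewrite lebesgue_measure_itv/= lte_fin ltr01 -EFinB subr0 mule1.
Qed.

End density.

Section car_law.
Variables (mu : probability (csZ R) R) (P : probability (csX R) R).
Hypothesis carmu : CAR (@cs_mu0 R) (@cs_pi R) (@cs_psi R) mu.
Hypothesis muP : forall A, measurable A -> P A = pushforward mu (@cs_psi R) A.

(** The reference measure does not charge the complement of the square, hence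
by absolute continuity neither does [mu]. *)
Lemma cs_CAR_law_carrier : @cs_laws R P.
Proof.
have [mumu0 _] := carmu.
have mD := measurable_cs_data.
have mC := measurableC mD.
have PC : P (~` @cs_data R) = 0%E.
  have mN : measurable (@cs_psi R @^-1` ~` @cs_data R).
    by rewrite -[X in measurable X]setTI; exact: measurable_cs_psi.
  rewrite muP//; apply/(measure0_null_setP _ mN)/mumu0/measure0_null_setP => //.
  rewrite /= /mrestr [X in (_ \x _)%E X](_ : _ = set0) ?measure0//.
  apply/seteqP; split => // z [] /= nD [_ z2]; exact: nD.
by rewrite /cs_laws/= -[X in P X]setCK probability_setC// PC sube0.
Qed.

Lemma cs_CAR_law_bound : (cs_Phi P).1 * (cs_Phi P).2 <= 1 / 16.
Proof.
have [_ [g [h [[g0 gE] [h0 h1] muE]]]] := carmu.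
have PE A : measurable A -> P A =
    (\int[@cs_mu0 R]_(z in @cs_psi R @^-1` A)
      (g (cs_psi z) * h (cs_pi z))%:E)%E.
  move=> mA; rewrite muP//; apply: muE.
  by rewrite -[X in measurable X]setTI; exact: measurable_cs_psi.
have mA1 := measurable_cs_A1; have mA2 := measurable_cs_A2.
pose I1 : set (csY R) := [set` `[0, 2^-1]].
(* Data in A2 have y > c >= 1/2, so the half-open interval is enough; it makes
   the two ranges of y disjoint, with total [h]-mass 1. *)
pose I2 : set (csY R) := [set` `]2^-1, 1]].
pose J2 : set (csY R) := [set` `[2^-1, 1]].
have mI1 : measurable I1 by exact: measurable_itv.
have mI2 : measurable I2 by exact: measurable_itv.
have mJ2 : measurable J2 by exact: measurable_itv.
have I1sub : I1 `<=` `[0, 1] by move=> x; rewrite /I1/= !in_itv/=; lra.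
have I2sub : I2 `<=` `[0, 1] by move=> x; rewrite /I2/= !in_itv/=; lra.
have J2sub : J2 `<=` `[0, 1] by move=> x; rewrite /J2/= !in_itv/=; lra.
have P1 : (P (@cs_A1 R) <= \int[leb]_(y in I1) (h y)%:E *
    \int[leb]_(c in I1) (g (c, true))%:E)%E.
  rewrite PE//; apply: cs_density_le => // -[y c] [/=].
  rewrite /I1 /cs_psi/= !in_itv/= => /andP[y0 y1] _ [/=].
  by rewrite in_itv/= => /andP[-> c2] yc; rewrite y0 (le_trans yc c2) c2.
have P2 : (P (@cs_A2 R) <= \int[leb]_(y in I2) (h y)%:E *
    \int[leb]_(c in J2) (g (c, false))%:E)%E.
  rewrite PE//; apply: cs_density_le => // -[y c] [/=].
  rewrite /I2 /J2 /cs_psi/= !in_itv/= => /andP[y0 y1] _ [/=].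
  rewrite in_itv/= => /andP[c2 c1] yc; split => //; last exact/andP.
  by rewrite y1 andbT (le_lt_trans c2)// ltNge yc.
apply: (fineM_le_16th _ _ _ _ _ _ _ _ P1 P2) => //.
- by apply: integral_ge0 => y _; rewrite lee_fin.
- by apply: integral_ge0 => y _; rewrite lee_fin.
- by apply: integral_ge0 => y _; rewrite lee_fin.
- by apply: integral_ge0 => y _; rewrite lee_fin.
- rewrite -ge0_integral_setU//; last 3 first.
  + apply: measurable_funTS; exact/measurable_EFinP.
  + by move=> y _; rewrite lee_fin.
  + rewrite disj_set2E; apply/eqP/seteqP; split => // x [].
    by rewrite /I1 /I2/= !in_itv/=; lra.
  rewrite -[RHS](cs_marginal_density h0 h1); congr (integral _ _ _).
  apply/seteqP; split => [x [|]|x]; rewrite /I1 /I2/= !in_itv/=; [lra|lra|].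
  by case: (leP x 2^-1) => xh; [left|right]; lra.
- apply: le_trans (car_halves_le1 g0 gE).
  have mgb b : measurable_fun setT (fun c : csY R => (g (c, b))%:E).
    by apply/measurable_EFinP; apply: (measurableT_comp (f := g)).
  have mgT b (D : set (csY R)) := measurable_funTS (D := D) (mgb b).
  have U := @integral_itv_bndoo R 0 2^-1 _ true false (mgT true _).
  have V := @integral_itv_bndoo R 2^-1 1 _ true false (mgT false _).
  by rewrite -U -V.
Qed.

End car_law.
End current_status.

Theorem mainTheorem4 (R : realType) :
  [/\ @cs_Phi R @` @cs_laws R =
        [set a : R * R | [/\ 0 <= a.1 <= 1, 0 <= a.2 <= 1 & a.1 + a.2 <= 1]],
      @cs_Phi R @` @cs_CAR_laws R `<=`
        [set a : R * R | [/\ 0 <= a.1 <= 1, 0 <= a.2 <= 1, a.1 + a.2 <= 1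
                           & a.1 * a.2 <= 1 / 16]],
      @cs_Phi R @` @cs_CAR_laws R `<` @cs_Phi R @` @cs_laws R
    & exists P : probability (csX R) R,
        @cs_laws R P /\ ~ @cs_CAR_laws R P].
Proof.
have bound : @cs_Phi R @` @cs_CAR_laws R `<=`
    [set a : R * R | [/\ 0 <= a.1 <= 1, 0 <= a.2 <= 1, a.1 + a.2 <= 1
                       & a.1 * a.2 <= 1 / 16]].
  move=> _ [P [mu [carmu muP]] <-] /=.
  have [? ? ?] := cs_Phi_simplex P; split => //.
  exact: cs_CAR_law_bound carmu muP.
have half0 : (0 : R) <= 2^-1 by lra.
have half1 : (2^-1 + 2^-1 : R) <= 1 by lra.
have [P [lawP PhiP]] := exists_cs_law half0 half0 half1.
have notCAR : ~ (@cs_Phi R @` @cs_CAR_laws R) (2^-1, 2^-1).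
  by move=> /bound[/= _ _ _]; lra.
split => //.
- apply/seteqP; split => [_ [Q _ <-]|[a b] /= [/andP[a0 _] /andP[b0 _] ab]].
    exact: cs_Phi_simplex.
  by have [Q [lawQ PhiQ]] := exists_cs_law a0 b0 ab; exists Q.
- split.
    move=> _ [Q [mu [carmu muQ]] <-]; exists Q => //.
    exact: cs_CAR_law_carrier carmu muQ.
  by move=> sub; apply: notCAR; apply: sub; exists P.
- by exists P; split => // carP; apply: notCAR; exists P.
Qed.
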